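(* Let $n,d \ge 3$ and $2 \le i \le n$ be integers. Suppose $n \ge id$. Then, as $q\to+\infty$ over prime powers, $$|w_i(q,n,d)| \in O \left( q^M \right), \quad \text{where } M= \max \left\{ i(d+1)-1-\binom{i+1}{2}, \ d(i^2-i+1)-i-\binom{i+1}{2} \right\}.$$
   Context: Let $q$ be a prime power. The Hamming weight of $v \in \mathbb{F}_q^n$ is the number of its nonzero coordinates. For integers $n,d\ge 1$, the higher-weight Dowling lattice $\mathcal{H}(q,n,d)$ is the set, ordered by inclusion, of all $\mathbb{F}_q$-linear subspaces of $\mathbb{F}_q^n$ that have a basis made of vectors of Hamming weight at most $d$, together with the zero space. It is a finite geometric lattice whose rank function is the $\mathbb{F}_q$-dimension. With $\mu$ the Möbius function of $\mathcal{H}(q,n,d)$, the $i$-th Whitney number (of the first kind) is $w_i(q,n,d)=\sum_{U \in \mathcal{H}(q,n,d),\ \dim U=i} \mu(\{0\},U)$. In the asymptotic estimate the parameters $n,d,i$ are fixed constants. *)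

(* Defs.v *)
From HB Require Import structures.
From mathcomp Require Import all_boot all_order all_algebra.
From mathcomp Require Import reals.

Set Implicit Arguments.
Unset Strict Implicit.
Unset Printing Implicit Defensive.

Import Order.TTheory GRing.Theory Num.Theory.
Local Open Scope ring_scope.

Section Mobius.

Variables (disp : Order.disp_t) (T : finPOrderType disp).

(* The recursion defining the Moebius function of a finite poset. [k] is fuel,
   sufficient once it exceeds the number of elements of the interval [x, y[;
   see [mobiusxx], [mobius_lt] and [mobius_nle] below. *)
Fixpoint mobius_rec (k : nat) (x y : T) : int :=
  if k isn't k'.+1 then 0
  else if x == y then 1
  else if (x < y)%O then
    - \sum_(z | (x <= z)%O && (z < y)%O) mobius_rec k' x z
  else 0.

Definition mobius (x y : T) : int := mobius_rec #|T|.+1 x y.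

Lemma mobius_rec_fuel k l x y :
    (#|[set z | (x <= z)%O && (z < y)%O]| < k)%N ->
    (#|[set z | (x <= z)%O && (z < y)%O]| < l)%N ->
  mobius_rec k x y = mobius_rec l x y.
Proof.
elim: k l y => [|k IHk] [|l] y //= ltk ltl.
case: eqP => // _; case: ifP => // ltxy; congr (- _).
apply: eq_bigr => z /andP[lexz ltzy].
suff ltc : (#|[set t | (x <= t)%O && (t < z)%O]| <
            #|[set t | (x <= t)%O && (t < y)%O]|)%N.
  by apply: IHk; apply: leq_trans ltc _.
apply/proper_card/properP; split.
  apply/subsetP => t; rewrite !inE => /andP[-> ltz] /=.
  exact: lt_trans ltz ltzy.
by exists z; rewrite !inE ?ltxx ?andbF // lexz.
Qed.

Lemma mobiusxx x : mobius x x = 1.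
Proof. by rewrite /mobius /= eqxx. Qed.

Lemma mobius_lt x y : (x < y)%O ->
  mobius x y = - \sum_(z | (x <= z)%O && (z < y)%O) mobius x z.
Proof.
move=> ltxy; rewrite {1}/mobius /= (lt_eqF ltxy) ltxy; congr (- _).
apply: eq_bigr => z /andP[lexz ltzy]; apply: mobius_rec_fuel.
  apply: (@leq_trans #|[set~ z]|.+1); last first.
    by rewrite cardsC1 prednK //; apply/card_gt0P; exists z.
  rewrite ltnS; apply/subset_leq_card/subsetP => t.
  by rewrite !inE => /andP[_ /lt_eqF ->].
by rewrite ltnS max_card.
Qed.

Lemma mobius_nle x y : ~~ (x <= y)%O -> mobius x y = 0.
Proof.
move=> nle; rewrite /mobius /=.
case: eqP nle => [->|_]; first by rewrite lexx.
by rewrite lt_def; case: (x <= y)%O; rewrite ?andbF.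
Qed.

End Mobius.

(* The subType structure of {vspace vT} is not exported by vector.v, so these
   cannot be built with [by <:]. *)
HB.instance Definition _ (F : finFieldType) (vT : vectType F) :
  isCountable {vspace vT} := CanIsCountable (@VectorInternalTheory.vs2mxK F vT).
HB.instance Definition _ (F : finFieldType) (vT : vectType F) :
  isFinite {vspace vT} := CanIsFinite (@VectorInternalTheory.vs2mxK F vT).

Definition hamming_weight (F : finFieldType) (n : nat) (v : 'rV[F]_n) : nat :=
  #|[set j | v 0 j != 0]|.

Section Dowling.

Variables (F : finFieldType) (n d : nat).

Definition in_dowling (U : {vspace 'rV[F]_n}) : bool :=
  (U == 0%VS) ||
  [exists X : (\dim U).-tuple 'rV[F]_n,
     basis_of U X && all (fun v => hamming_weight v <= d)%N X].

(* The higher-weight Dowling lattice H(q, n, d) with q = #|F|. Its order below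
   is inclusion, its bottom the zero space, and its rank function [\dim]. *)
Record dowling := Dowling {
  dowling_space :> {vspace 'rV[F]_n};
  _ : in_dowling dowling_space }.

HB.instance Definition _ := [isSub for dowling_space].
HB.instance Definition _ := [Finite of dowling by <:].

Definition dowling_le (U V : dowling) : bool := (U <= V)%VS.

Lemma dowling_le_refl : reflexive dowling_le.
Proof. by move=> U; apply: subvv. Qed.

Lemma dowling_le_anti : antisymmetric dowling_le.
Proof. by move=> U V leUV; apply/val_inj/subv_anti. Qed.

Lemma dowling_le_trans : transitive dowling_le.
Proof. by move=> V U W; apply: subv_trans. Qed.

Fact dowling_display : Order.disp_t. Proof. exact: Order.Disp tt tt. Qed.

HB.instance Definition _ := Order.Le_isPOrder.Build dowling_display dowling
  dowling_le_refl dowling_le_anti dowling_le_trans.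

Lemma in_dowling0 : in_dowling 0%VS.
Proof. by rewrite /in_dowling eqxx. Qed.

Lemma dowling_le0 (U : dowling) : (Dowling in_dowling0 <= U)%O.
Proof. exact: sub0v. Qed.

HB.instance Definition _ :=
  Order.hasBottom.Build dowling_display dowling dowling_le0.

Definition whitney (i : nat) : int :=
  \sum_(U : dowling | \dim U == i) mobius (\bot : dowling)%O U.

End Dowling.

(* Main.v *)
Require Import Defs.
From mathcomp Require Import all_boot all_order all_algebra.
From mathcomp Require Import reals zify.
Import Order.TTheory GRing.Theory Num.Theory.
Local Open Scope ring_scope.

(** A Whitney number of a geometric lattice is controlled by its number of atoms
    alone, and here that crude control already suffices.  Let a be the number of
    atoms, up to a factor depending only on n.  Summing the recursion
    mu(0,U) = - sum_(W < U) mu(0,W) over all U of dimension m and exchanging the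
    sums bounds S_m, the sum of |mu(0,U)| over dim U = m, by the sum over j < m of
    S_j times the largest number of U of dimension m above a W of dimension j.
    As U is generated by its atoms, it is W plus the span of m - j atoms
    ([dowling_spanned_over]), so that there are at most a^(m-j) such U
    ([card_dowling_above]).  By induction S_m <= (2a)^m ([sum_norm_mobius_le]).

    An atom is a line generated by a vector of weight at most d, which can be
    scaled to have one coordinate equal to 1; choosing the support, that
    coordinate and the others gives a <= 2^n n q^(d-1)
    ([card_low_weight_point]).  Hence w_i = O(q^(i(d-1))), and i(d-1) is at most
    the second term of the maximum, since the difference of the two is
    d(i-1)^2 - i(i+1)/2 >= 3(i-1)^2 - i(i+1)/2 = (5i-3)(i-2)/2 >= 0. *)

(** Representatives of the atoms: scaling some coordinate to 1 saves the factor q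
    by which the low-weight vectors outnumber the lines they span.  A line may
    have several representatives, but at most n of them. *)
Definition low_weight_point (F : finFieldType) (n d : nat) : {set 'rV[F]_n} :=
  [set v | (hamming_weight v <= d)%N && [exists k, v 0 k == 1]].

Lemma card_low_weight_point (F : finFieldType) (n d : nat) : (0 < d)%N ->
  (#|low_weight_point F n d| <= 2 ^ n * n * #|F| ^ d.-1)%N.
Proof.
move=> d_gt0; have F_gt0 : (0 < #|F|)%N by apply/card_gt0P; exists 0.
pose B (p : {set 'I_n} * 'I_n) := [set v : 'rV[F]_n |
  [&& (#|p.1| <= d)%N, p.2 \in p.1, v 0 p.2 == 1 &
      [forall j, (v 0 j != 0) ==> (j \in p.1)]]].
have cardB p : (#|B p| <= #|F| ^ d.-1)%N.
  case: p => J k; rewrite /B /=.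
  case: (boolP ((#|J| <= d)%N && (k \in J))) => [/andP[Jd kJ]|nJ]; last first.
    rewrite (_ : [set _ | _] = set0) ?cards0 //; apply/setP => v.
    by rewrite !inE andbA (negPf nJ).
  (* Erasing the coordinate known to be 1 loses nothing, and leaves a function
     supported on |J| - 1 <= d - 1 positions. *)
  pose h (v : 'rV[F]_n) := [ffun j => if j == k then 0 else v 0 j].
  set S := [set _ | _].
  have h_inj : {in S &, injective h}.
    move=> u v; rewrite !inE Jd kJ /= => /andP[/eqP uk _] /andP[/eqP vk _].
    move=> /ffunP huv; apply/rowP => j; have := huv j; rewrite !ffunE.
    by case: eqP => // ->; rewrite uk vk.
  rewrite -(card_in_imset h_inj).
  apply: (@leq_trans #|pffun_on (0 : F) (J :\ k) [set: F]|); last first.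
    rewrite card_pffun_on cardsT leq_pexp2l //.
    by rewrite -ltnS prednK // (leq_trans _ Jd) // [in leqRHS](cardsD1 k J) kJ.
  apply/subset_leq_card/subsetP => g /imsetP[v]; rewrite inE => /and4P[_ _ _ sv] ->.
  apply/pffun_onP; split; last by move=> x; rewrite inE.
  apply/subsetP => j; rewrite !inE ffunE; case: (j == k); rewrite ?eqxx //= => vj.
  by have /forallP/(_ j)/implyP := sv; apply.
apply: (@leq_trans #|\bigcup_p B p|).
  apply/subset_leq_card/subsetP => v; rewrite inE => /andP[wv /existsP[k vk]].
  apply/bigcupP; exists ([set j | v 0 j != 0], k) => //.
  rewrite !inE /= wv vk (eqP vk) oner_neq0 /=.
  by apply/forallP => j; rewrite inE implybb.
apply: (@leq_trans (\sum_(p : {set 'I_n} * 'I_n) #|B p|)).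
  elim/big_ind2: _ => [|X a Y b Xa Yb|//]; first by rewrite cards0.
  by rewrite (leq_trans _ (leq_add Xa Yb)) // cardsU leq_subr.
apply: (leq_trans (leq_sum _ (fun p _ => cardB p))).
by rewrite sum_nat_const card_prod -cardsT -powersetT card_powerset cardsT card_ord.
Qed.

(** Steinitz exchange: the low-weight vectors generating U cannot all lie in a
    proper subspace W, and adjoining one that does not raises the dimension
    of W by exactly one.  The intermediate spaces are arbitrary subspaces, so
    the induction needs W only as a subspace. *)
Lemma dowling_spanned_over (F : finFieldType) (n d m : nat)
    (U W : {vspace 'rV[F]_n}) :
  in_dowling d U -> (W <= U)%VS -> \dim U = (\dim W + m)%N ->
  exists X : m.-tuple {v | v \in low_weight_point F n d},
    U = (W + <<map val X>>)%VS.
Proof.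
move=> dowlU; elim: m W => [|m IHm] W leWU dimU.
  exists [tuple]; rewrite /= span_nil addv0; apply/eqP.
  by rewrite eq_sym -(dimv_leqif_eq leWU) dimU addn0.
have [v [vU vW lowv]] : exists v, [/\ v \in U, v \notin W &
    v \in low_weight_point F n d].
  have /orP[/eqP U0|/existsP[X /andP[basX wX]]] := dowlU.
    by move: dimU; rewrite /= U0 dimv0 addnS.
  have /hasP[v vX vW] : has (fun v => v \notin W) X.
    apply: contraPT dimU => nX; apply/eqP; rewrite neq_ltn addnS ltnS.
    apply/orP; left; rewrite (leq_trans _ (leq_addr _ _)) // dimvS //.
    have /andP[leUX _] : (U <= <<X>>)%VS && (size X <= \dim U)%N by rewrite -basisEdim.
    apply: subv_trans leUX _; apply/span_subvP => v vX.
    by apply: contraR nX => vW; apply/hasP; exists v.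
  have [k vk] : exists k, v 0 k != 0.
    apply/existsP; apply: contraR vW; rewrite negb_exists => /forallP v0.
    rewrite (_ : v = 0) ?mem0v //; apply/rowP => k; rewrite mxE.
    by apply/eqP; rewrite -[_ == _]negbK.
  have vk' : (v 0 k)^-1 != 0 by rewrite invr_eq0.
  exists ((v 0 k)^-1 *: v); split.
  - exact: memvZ (basis_mem basX vX).
  - by apply: contra vW => /(memvZ (v 0 k)); rewrite scalerA divff // scale1r.
  rewrite inE; apply/andP; split; last by apply/existsP; exists k; rewrite mxE mulVf.
  rewrite (leq_trans _ (allP wX v vX)) // subset_leq_card //.
  by apply/subsetP => j; rewrite !inE mxE mulf_eq0 (negPf vk').
have leW'U : (W + <[v]> <= U)%VS by rewrite subv_add leWU -memvE.
have dimW' : \dim (W + <[v]>) = (\dim W).+1.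
  apply/eqP; rewrite eqn_leq; apply/andP; split.
    have [le_ _] := dimv_add_leqif W <[v]>.
    by rewrite (leq_trans le_) // dim_vline -[leqRHS]addn1 leq_add2l leq_b1.
  rewrite ltn_neqAle dimvS ?addvSl // andbT.
  rewrite (dimv_leqif_eq (addvSl W <[v]>)); apply: contra vW => /eqP ->.
  by rewrite memvE addvSr.
have [|X defU] := IHm _ leW'U; first by rewrite dimU dimW' addnS addSn.
by exists (cons_tuple (exist _ v lowv) X); rewrite defU /= span_cons addvA.
Qed.

Lemma card_dowling_above (F : finFieldType) (n d m : nat) (W : dowling F n d) :
  (#|[set U : dowling F n d | (W <= U)%O & \dim U == (\dim W + m)%N]|
     <= #|low_weight_point F n d| ^ m)%N.
Proof.
rewrite -[in leqRHS]card_sig -card_tuple -(card_imset _ val_inj).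
pose span_over (X : m.-tuple {v | v \in low_weight_point F n d}) :=
  (W + <<map val X>>)%VS.
apply: leq_trans (leq_imset_card span_over _).
apply/subset_leq_card/subsetP => V /imsetP[U]; rewrite inE => /andP[leWU /eqP dimU] ->.
have [X defU] := dowling_spanned_over F n d m U W (valP U) leWU dimU.
by apply/imsetP; exists X.
Qed.

Lemma dim_dowling_lt (F : finFieldType) (n d : nat) (W U : dowling F n d) :
  (W < U)%O -> (\dim W < \dim U)%N.
Proof.
rewrite lt_neqAle => /andP[neqWU leWU]; rewrite ltn_neqAle (dimvS leWU) andbT.
by rewrite (dimv_leqif_eq leWU).
Qed.

(** The factor 2^m absorbs the recursion, because the powers 2^j with j < m sum
    to 2^m - 1. *)
Lemma sum_norm_mobius_le (F : finFieldType) (n d m : nat) :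
  \sum_(U : dowling F n d | \dim U == m) `|mobius (\bot : dowling F n d)%O U|
    <= ((2 * #|low_weight_point F n d|) ^ m)%:Z.
Proof.
set a := #|_|.
pose S j : int :=
  \sum_(U : dowling F n d | \dim U == j) `|mobius (\bot : dowling F n d)%O U|.
rewrite -/(S m); elim/ltn_ind: m => -[|m] IHm.
  rewrite /S (bigD1 (\bot : dowling F n d)%O) /= ?dimv0 //.
  rewrite mobiusxx big1 => // U /andP[dU].
  by rewrite -(inj_eq val_inj) /= -dimv_eq0 dU.
have step : S m.+1 <= \sum_(j < m.+1) S j * (a ^ (m.+1 - j))%:Z.
  have: S m.+1 <= \sum_(U : dowling F n d | \dim U == m.+1)
      \sum_(W : dowling F n d | (W < U)%O) `|mobius (\bot : dowling F n d)%O W|.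
    apply: ler_sum => U /eqP dU; rewrite mobius_lt; last first.
      rewrite lt_neqAle le0x andbT; apply/eqP => U0.
      by move: dU; rewrite -U0 /= dimv0.
    rewrite normrN (le_trans (ler_norm_sum _ _ _)) //.
    by rewrite le_eqVlt; apply/orP; left; apply/eqP/eq_bigl => W; rewrite le0x.
  move/le_trans; apply.
  rewrite (exchange_big_dep (fun W : dowling F n d => \dim W < m.+1)%N) /=; last first.
    by move=> U W /eqP <- /dim_dowling_lt.
  apply: (@le_trans _ _ (\sum_(W : dowling F n d | (\dim W < m.+1)%N)
      `|mobius (\bot : dowling F n d)%O W| * (a ^ (m.+1 - \dim W))%:Z)).
    apply: ler_sum => W dW; rewrite sumr_const -mulr_natr ler_wpM2l // natz lez_nat.
    apply: leq_trans (card_dowling_above F n d _ W); apply/subset_leq_card/subsetP => U.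
    by rewrite !inE unfold_in subnKC ?(ltnW dW) // => /andP[-> /ltW ->].
  (* Group the W by dimension. *)
  rewrite (partition_big (fun W : dowling F n d => inord (\dim W) : 'I_m.+1) xpredT) //=.
  apply: ler_sum => j _; rewrite /S mulr_suml le_eqVlt; apply/orP; left; apply/eqP.
  apply: eq_big => [W|W /andP[dW /eqP <-]]; last by rewrite inordK.
  case: ltnP => dW /=.
    by apply/eqP/eqP => [<-|dj]; [rewrite inordK|apply: val_inj; rewrite /= inordK].
  by apply/esym/eqP => dj; have := ltn_ord j; rewrite -dj ltnNge dW.
apply: (le_trans step).
apply: (@le_trans _ _ (\sum_(j < m.+1) (2 ^ j * a ^ m.+1)%:Z)).
  apply: ler_sum => j _; apply: le_trans (ler_wpM2r _ (IHm j (ltn_ord j))) _ => //.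
  by rewrite -PoszM lez_nat expnMn -mulnA -expnD subnKC // ltnW.
rewrite expnMn -(big_morph Posz PoszD (erefl _)) lez_nat -big_distrl /=.
rewrite leq_mul2r; apply/orP; right.
elim: (m.+1) => [|k IHk]; first by rewrite big_ord0.
by rewrite big_ord_recr /= expnS mul2n -addnn leq_add2r.
Qed.

Theorem theorem10p7 (R : realType) (n d i : nat)
    (hn : (3 <= n)%N) (hd : (3 <= d)%N) (hi : (2 <= i <= n)%N)
    (hnid : (i * d <= n)%N) :
  let M : int :=
    Num.max (i%:Z * (d%:Z + 1) - 1 - 'C(i.+1, 2)%:Z)
            (d%:Z * (i%:Z ^+ 2 - i%:Z + 1) - i%:Z - 'C(i.+1, 2)%:Z) in
  exists (C : R) (q0 : nat), forall F : finFieldType, (q0 <= #|F|)%N ->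
    `|whitney F n d i|%:~R <= C * #|F|%:R ^ M.
Proof.
move=> M; exists ((2 * (2 ^ n * n)) ^ i)%:R, 0%N => F _.
have F_gt0 : (0 < #|F|)%N by apply/card_gt0P; exists 0.
have leM : (d.-1 * i)%:Z <= M.
  rewrite le_max; apply/orP; right.
  have binE : 'C(i.+1, 2)%:Z * 2 = i%:Z * (i%:Z + 1).
    by rewrite -[2]/(2%N%:Z) -PoszM muln2 bin2 halfK /= oddM /=; lia.
  (* The difference grows with d, and at d = 3 it is (5i - 3)(i - 2) / 2. *)
  nia.
have whitney_le : `|whitney F n d i| <=
    ((2 * (2 ^ n * n)) ^ i * #|F| ^ (d.-1 * i))%:Z.
  apply: le_trans (ler_norm_sum _ _ _) (le_trans (sum_norm_mobius_le F n d i) _).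
  rewrite lez_nat expnM -expnMn leq_exp2r; last by lia.
  by rewrite -[leqRHS]mulnA leq_mul2l card_low_weight_point //; lia.
apply: (@le_trans _ _ ((2 * (2 ^ n * n)) ^ i * #|F| ^ (d.-1 * i))%N%:R).
  by rewrite -[leRHS]/((Posz _)%:~R) ler_int.
rewrite natrM ler_wpM2l ?ler0n // natrX exprnP ler_weXz2l //.
by rewrite ler1n.
Qed.
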